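(* Let $p \in [2,\infty)$ and let $q$ be defined by $\frac1p + \frac1q = 1$. Let \[ K = \{ (x,y,z)^T \in \mathbb R^3 \mid -x^{1/p}y^{1/q} \leq z \leq x^{1/p}y^{1/q},\ x \geq 0,\ y \geq 0\}, \] and let $F$ be the canonical potential of $K$. Then the level set $\{F = 0\}$, which is a complete hyperbolic affine sphere asymptotic to $\partial K$, is given by the hypersurface immersion \[ \mathbb R^2 \ni \begin{pmatrix} \zeta \\ \mu \end{pmatrix} \mapsto \begin{pmatrix} x \\ y \\ z \end{pmatrix} = (p+q)^{-\frac16}\begin{pmatrix} (\zeta^2+p+1)^{\frac{p+1}{6p}}(\zeta^2+q+1)^{\frac{q+1}{6q}}\exp\left(\frac{q+1}{3q}\mu\right) \\ (\zeta^2+p+1)^{\frac{p+1}{6p}}(\zeta^2+q+1)^{\frac{q+1}{6q}}\exp\left(-\frac{p+1}{3p}\mu\right) \\ (\zeta^2+p+1)^{\frac{p-2}{6p}}(\zeta^2+q+1)^{\frac{q-2}{6q}}\,\zeta\,\exp\left(-\frac{p-q}{3(p+q)}\mu\right) \end{pmatrix}. \]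
   Context: A convex cone in $\mathbb R^n$ is regular if it is closed, has non-empty interior, and contains no line. The canonical potential of a regular convex cone $K\subset\mathbb R^n$ is the unique smooth solution $F: K^o \to \mathbb R$ ($K^o$ the interior of $K$) of the Monge-Ampère problem $\det F'' = e^{2F}$, $F|_{\partial K} = +\infty$, $F'' \succ 0$, where $F''$ is the Hessian in the standard coordinates and the boundary condition means that $F(x) \to +\infty$ as $x$ tends to a boundary point of $K$. It is known that this solution exists and is unique, and that the complete hyperbolic affine spheres asymptotic to the boundary of $K$ (in the sense of equiaffine differential geometry: convex hypersurfaces whose affine normals all meet at the vertex of $K$, which separate their convex hull from that point, and which are complete in the affine metric) are exactly the level sets of $F$; they are related to each other by homotheties. *)

(* Defs.v *)
From HB Require Import structures.
From mathcomp Require Import all_boot all_order all_algebra.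
From mathcomp Require Import all_classical all_reals all_analysis.

Set Implicit Arguments.
Unset Strict Implicit.
Unset Printing Implicit Defensive.

Import Order.TTheory GRing.Theory Num.Theory.
Import numFieldTopology.Exports numFieldNormedType.Exports.

Local Open Scope classical_set_scope.
Local Open Scope ring_scope.

(* Points of R^n are row vectors, as for the Jacobian 'J f x. *)

Definition regular_convex_cone (R : realType) (n : nat)
    (K : set 'rV[R]_n) : Prop :=
  [/\ forall (x : 'rV[R]_n) (t : R), K x -> 0 < t -> K (t *: x),
      convex_set K,
      closed K,
      K° !=set0
    & ~ exists x v : 'rV[R]_n, v != 0 /\ forall t : R, K (x + t *: v)].

Definition partial (R : realType) (n : nat) (W : normedModType R)
    (i : 'I_n) (f : 'rV[R]_n -> W) : 'rV[R]_n -> W :=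
  'D_(delta_mx 0 i) f.

Definition iter_partial (R : realType) (n : nat) (W : normedModType R)
    (s : seq 'I_n) (f : 'rV[R]_n -> W) : 'rV[R]_n -> W :=
  foldr (fun i g => partial i g) f s.

(* C^oo on an open set D.  Differentiability of an iterated partial derivative
   gives both its continuity and the existence of the next ones; it cannot be
   replaced by mere existence, as 'D_v f x is a default value when f has no
   derivative at x along v. *)
Definition smooth_on (R : realType) (n : nat) (W : normedModType R)
    (D : set 'rV[R]_n) (f : 'rV[R]_n -> W) : Prop :=
  forall (s : seq 'I_n) (x : 'rV[R]_n), D x -> differentiable (iter_partial s f) x.

Definition smooth_immersion (R : realType) (n m : nat)
    (f : 'rV[R]_n -> 'rV[R]_m) : Prop :=
  smooth_on setT f /\ forall u : 'rV[R]_n, row_free ('J f u).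

Definition hessian (R : realType) (n : nat) (F : 'rV[R]_n -> R)
    (x : 'rV[R]_n) : 'M[R]_n :=
  \matrix_(i, j) partial i (partial j (F : 'rV[R]_n -> R^o)) x.

Definition pos_def (R : realType) (n : nat) (A : 'M[R]_n) : Prop :=
  A^T = A /\ forall v : 'rV[R]_n, v != 0 -> 0 < (v *m A *m v^T) 0 0.

(* F is a total function of which only the restriction to K° is meaningful. *)
Definition monge_ampere_solution (R : realType) (n : nat)
    (K : set 'rV[R]_n) (F : 'rV[R]_n -> R) : Prop :=
  [/\ smooth_on K° (F : 'rV[R]_n -> R^o),
      forall x, K° x -> \det (hessian F x) = expR (2 * F x),
      forall x, K° x -> pos_def (hessian F x)
    & forall b, (closure K `\` K°) b ->
        F x @[x --> within K° (nbhs b)] --> +oo].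

(* "The unique solution": uniqueness is part of the definition, and it is
   uniqueness as a function on K°. *)
Definition canonical_potential (R : realType) (n : nat)
    (K : set 'rV[R]_n) (F : 'rV[R]_n -> R) : Prop :=
  monge_ampere_solution K F /\
  forall G, monge_ampere_solution K G -> forall x, K° x -> G x = F x.

Definition row3 (R : realType) (a b c : R) : 'rV[R]_3 :=
  \row_(i < 3) [:: a; b; c]`_i.

(* The cone K; the powers `^ have nonnegative bases here, where a `^ r is the
   usual real power. *)
Definition power_cone (R : realType) (p q : R) : set 'rV[R]_3 :=
  [set v | let x := v 0 0 in let y := v 0 1 in let z := v 0 2 in
    [/\ - (x `^ p^-1 * y `^ q^-1) <= z,
        z <= x `^ p^-1 * y `^ q^-1,
        0 <= x & 0 <= y]].

Definition power_sphere (R : realType) (p q : R) (u : 'rV[R]_2) : 'rV[R]_3 :=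
  let zeta := u 0 0 in let mu := u 0 1 in
  let A := zeta ^+ 2 + p + 1 in
  let B := zeta ^+ 2 + q + 1 in
  (p + q) `^ (- 6^-1) *:
  row3
    (A `^ ((p + 1) / (6 * p)) * B `^ ((q + 1) / (6 * q)) *
       expR ((q + 1) / (3 * q) * mu))
    (A `^ ((p + 1) / (6 * p)) * B `^ ((q + 1) / (6 * q)) *
       expR (- ((p + 1) / (3 * p)) * mu))
    (A `^ ((p - 2) / (6 * p)) * B `^ ((q - 2) / (6 * q)) * zeta *
       expR (- ((p - q) / (3 * (p + q))) * mu)).

(* Main.v *)
Require Import Defs.
From mathcomp Require Import all_boot all_order all_algebra.
From mathcomp Require Import all_classical all_reals all_analysis.
From mathcomp Require Import ring lra.
Import Order.TTheory GRing.Theory Num.Theory.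
Import numFieldTopology.Exports numFieldNormedType.Exports.

Set Implicit Arguments.
Unset Strict Implicit.
Unset Printing Implicit Defensive.

Local Open Scope classical_set_scope.
Local Open Scope ring_scope.

(* Uniqueness is part of the notion of canonical potential, so it suffices to
   exhibit one solution of the Monge-Ampere problem and to compute its zero set.
   The automorphisms diag(s, t, s^(1/p) t^(1/q)) of the cone force
     F = f(w) - (1 + 1/p) ln x - (1 + 1/q) ln y,   w = z x^(-1/p) y^(-1/q).
   Let A = zeta^2 + p + 1, B = zeta^2 + q + 1, and let zeta(w) be the inverse of
   the increasing bijection zeta |-> zeta A^(-1/2p) B^(-1/2q) from R onto
   (-1, 1).  Then
     f = (1 + 1/p)/2 ln A + (1 + 1/q)/2 ln B - ln(pq)/2
   is a solution, because its gradient is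
     (- A/(p x), - B/(q y), zeta A^(1/2p) B^(1/2q) x^(-1/p) y^(-1/q))
   and, up to a diagonal congruence, its Hessian is the rank-one update
   diag(A/p, B/q, -1) + (2AB/N) r^T r with r = (zeta/p, zeta/q, -1) and
   N = 3 zeta^2 + 2pq + 1, whose determinant is AB/(pq).  On the set F = 0 the
   numbers ln x and ln y solve a linear system with data zeta and
   mu = ln x - ln y, which gives the parametrisation. *)

(** * Functions of class C^k on an open set *)

(** A first-order expansion at [x] only involves values near [x], so the expansion of [f] serves for
    [g], and [diff_unique] identifies its linear part with the differential of [g]. *)
Lemma near_eq_differentiable (R : numFieldType) (V W : normedModType R)
    (f g : V -> W) (x : V) :
  {near x, f =1 g} -> differentiable f x -> differentiable g x.
Proof.
move=> fg df.
have [dfc /eqaddoP dfo] := (diff_locallyP x f).1 df.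
have gx : g x = f x by rewrite (nbhs_singleton fg).
have dgo : g \o shift x = cst (g x) + 'd f x +o_0 id.
  apply/eqaddoP => e e0.
  have fg0 : \forall h \near (0 : V), f (h + x) = g (h + x).
    by move: fg; rewrite (near_shift 0 x) /=; apply: filterS => h; rewrite /= subr0.
  apply: filterS2 fg0 (dfo _ e0) => h fgh; rewrite /= gx.
  by congr (`|_ - _| <= _).
apply/diff_locallyP; by rewrite (diff_unique dfc dgo); split.
Qed.

Section has_partials.
Context {R : realType} {n : nat}.
Implicit Types (x : 'rV[R]_n).

(** Differentiability is recorded with the values because the composition rule needs it, and because
    a partial derivative alone takes a default value where it does not exist. *)
Definition has_partials (W : normedModType R) (f : 'rV[R]_n -> W) x
    (d : 'I_n -> W) : Prop :=
  differentiable f x /\ forall i, partial i f x = d i.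

Lemma has_partials_cst (W : normedModType R) (c : W) x :
  has_partials (fun=> c) x (fun=> 0).
Proof.
split; first exact: differentiable_cst.
by move=> i; exact: derive_cst.
Qed.

Lemma derive_coord j x (e : 'rV[R]_n) :
  'D_e (fun v : 'rV[R]_n => v 0 j : R^o) x = e 0 j.
Proof.
apply/lim_near_cst => //; near=> h.
have h0 : h != 0 by near: h; exact: nbhs_dnbhs_neq.
by rewrite /= !mxE addrK /GRing.scale /= mulKf.
Unshelve. all: by end_near. Qed.

Lemma has_partials_coord j x :
  has_partials (fun v : 'rV[R]_n => v 0 j : R^o) x (fun i => (i == j)%:R).
Proof.
split=> [|i]; first exact: differentiable_coord.
by rewrite /partial derive_coord mxE eqxx eq_sym.
Qed.

Lemma has_partialsD (W : normedModType R) (f g : 'rV[R]_n -> W) x d e :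
  has_partials f x d -> has_partials g x e ->
  has_partials (fun v => f v + g v) x (fun i => d i + e i).
Proof.
move=> [df dE] [dg eE]; split; first exact: differentiableD.
by move=> i; rewrite -dE -eE; apply: deriveD; exact: diff_derivable.
Qed.

Lemma has_partialsM (f g : 'rV[R]_n -> R^o) x d e :
  has_partials f x d -> has_partials g x e ->
  has_partials (fun v => f v * g v : R^o) x (fun i => f x * e i + g x * d i).
Proof.
move=> [df dE] [dg eE]; split; first exact: differentiableM.
by move=> i; rewrite -dE -eE; apply: deriveM; exact: diff_derivable.
Qed.

Lemma has_partialsZl (W : normedModType R) (f : 'rV[R]_n -> R^o) (w : W) x d :
  has_partials f x d -> has_partials (fun v => f v *: w) x (fun i => d i *: w).
Proof.
move=> [df dE]; split; first exact: differentiableZl.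
move=> i; rewrite -dE /partial !deriveE//; last exact: differentiableZl.
by rewrite diffZl.
Qed.

Lemma has_partials_comp (f : 'rV[R]_n -> R^o) (g : R^o -> R^o) x d l :
  is_derive (f x) 1 g l -> has_partials f x d ->
  has_partials (fun v => g (f v) : R^o) x (fun i => l * d i).
Proof.
move=> [dg gE] [df dE].
have dg' : differentiable g (f x) by apply/derivable1_diffP.
split; first exact: (differentiable_comp df dg').
move=> i; rewrite -dE /partial deriveE; last exact: (differentiable_comp df dg').
rewrite (diff_comp df dg') /= diff1E// derive1E gE deriveE//.
by rewrite mulrC.
Qed.
Lemma has_partialsZ (f : 'rV[R]_n -> R^o) (c : R) x d : has_partials f x d ->
  has_partials (fun u => c * f u : R^o) x (fun i => c * d i).
Proof.
move=> fd; have := has_partialsM (has_partials_cst (c : R^o) x) fd.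
by congr has_partials; apply/funext => i; rewrite mulr0 addr0.
Qed.

Lemma has_partialsN (f : 'rV[R]_n -> R^o) x d : has_partials f x d ->
  has_partials (fun u => - f u : R^o) x (fun i => - d i).
Proof.
move=> /(has_partialsZ (-1)); congr has_partials; apply/funext => i;
  by rewrite mulN1r.
Qed.

(** The calculus rules build [d] by unification; what then remains is an algebraic identity between
    this raw family and the wanted one. *)
Lemma has_partials_eq (W : normedModType R) (f : 'rV[R]_n -> W) x d e :
  has_partials f x d -> (forall i, d i = e i) -> has_partials f x e.
Proof. by move=> fd /funext <-. Qed.

End has_partials.

Section Ck.
Context {R : realType} {n : nat}.
Implicit Types (D : set 'rV[R]_n) (k : nat).

(** The index is shifted: [Ck 0] already means differentiable, so [Ck k] is differentiability of all
    partial derivatives of order at most [k]. *)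
Fixpoint Ck (W : normedModType R) k D (f : 'rV[R]_n -> W) : Prop :=
  (forall x, D x -> differentiable f x) /\
  match k with
  | 0 => True
  | k'.+1 => forall i, Ck k' D (partial i f)
  end.

Lemma Ck_differentiable (W : normedModType R) k D (f : 'rV[R]_n -> W) x :
  D x -> Ck k D f -> differentiable f x.
Proof. by move=> Dx; case: k => [|k] [df _]; exact: df. Qed.

Lemma Ck_partial (W : normedModType R) k D (f : 'rV[R]_n -> W) i :
  Ck k.+1 D f -> Ck k D (partial i f).
Proof. by move=> [_ /(_ i)]. Qed.

Lemma CkW (W : normedModType R) k D (f : 'rV[R]_n -> W) :
  Ck k.+1 D f -> Ck k D f.
Proof.
elim: k f => [|k IH] f [df pf]; first by split.
by split=> // i; exact/IH/pf.
Qed.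

Lemma Ck_smooth (W : normedModType R) D (f : 'rV[R]_n -> W) :
  (forall k, Ck k D f) -> smooth_on D f.
Proof.
move=> fk s x Dx; have := fk (size s).
(* [iter_partial] applies the last index of [s] first, and [Ck] unfolds at the first derivative
   taken; hence the induction from the right end. *)
elim/last_ind: s f {fk} => [|s i IH] f; first exact: Ck_differentiable.
by rewrite size_rcons => -[_ /(_ i)/IH]; rewrite /iter_partial foldr_rcons.
Qed.

(** On an open set, equality is equality near each point, so it passes to the partial
    derivatives. *)
Lemma eq_in_Ck (W : normedModType R) k D (f g : 'rV[R]_n -> W) :
  open D -> (forall x, D x -> f x = g x) -> Ck k D f -> Ck k D g.
Proof.
move=> oD; elim: k f g => [|k IH] f g fg.
  move=> [df _]; split=> // x Dx; apply: near_eq_differentiable (df _ Dx).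
  by apply: filterS (open_nbhs_nbhs (conj oD Dx)) => y; exact: fg.
move=> [df pf]; split=> [x Dx|i].
  apply: near_eq_differentiable (df _ Dx).
  by apply: filterS (open_nbhs_nbhs (conj oD Dx)) => y; exact: fg.
apply: IH (pf i) => x Dx; apply: near_eq_derive.
by apply: filterS (open_nbhs_nbhs (conj oD Dx)) => y; exact: fg.
Qed.

Lemma Ck_step (W : normedModType R) k D (f : 'rV[R]_n -> W)
    (g : 'I_n -> 'rV[R]_n -> W) : open D ->
  (forall x, D x -> has_partials f x (fun i => g i x)) ->
  (forall i, Ck k D (g i)) -> Ck k.+1 D f.
Proof.
move=> oD fg gk; split=> [x /fg[]//|i]; apply: eq_in_Ck (gk i) => // x Dx.
by have [_ ->] := fg _ Dx.
Qed.

Lemma Ck_partials (W : normedModType R) k D (f : 'rV[R]_n -> W) x :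
  D x -> Ck k D f -> has_partials f x (fun i => partial i f x).
Proof. by move=> Dx /(Ck_differentiable Dx). Qed.

Lemma Ck_cst (W : normedModType R) k D (c : W) :
  open D -> Ck k D (fun=> c).
Proof.
move=> oD; elim: k c => [|k IH] c; first by split=> // x _; exact: differentiable_cst.
by apply: (@Ck_step _ _ _ _ (fun _ _ => 0)) => // x _; exact: has_partials_cst.
Qed.

Lemma Ck_coord k D j : open D -> Ck k D (fun v : 'rV[R]_n => v 0 j : R^o).
Proof.
move=> oD; case: k => [|k]; first by split=> // x _; have [] := has_partials_coord j x.
apply: (@Ck_step R^o _ _ _ (fun i _ => (i == j)%:R)) => // [x _|i].
  exact: has_partials_coord.
exact: Ck_cst.
Qed.

Lemma CkD (W : normedModType R) k D (f g : 'rV[R]_n -> W) : open D ->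
  Ck k D f -> Ck k D g -> Ck k D (fun v => f v + g v).
Proof.
move=> oD; elim: k f g => [|k IH] f g fk gk.
  by split=> // x Dx; apply: differentiableD;
    [exact: Ck_differentiable Dx fk|exact: Ck_differentiable Dx gk].
apply: (@Ck_step _ _ _ _ (fun i x => partial i f x + partial i g x)) => // [x Dx|i].
  by apply: has_partialsD; [exact: Ck_partials Dx fk|exact: Ck_partials Dx gk].
by apply: IH; [exact: Ck_partial|exact: Ck_partial].
Qed.

Lemma CkM k D (f g : 'rV[R]_n -> R^o) : open D ->
  Ck k D f -> Ck k D g -> Ck k D (fun v => f v * g v : R^o).
Proof.
move=> oD; elim: k f g => [|k IH] f g fk gk.
  by split=> // x Dx; apply: differentiableM;
    [exact: Ck_differentiable Dx fk|exact: Ck_differentiable Dx gk].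
apply: (@Ck_step R^o _ _ _ (fun i x => f x * partial i g x + g x * partial i f x))
  => // [x Dx|i].
  by apply: has_partialsM; [exact: Ck_partials Dx fk|exact: Ck_partials Dx gk].
by apply: CkD => //; apply: IH; [exact: CkW|exact: Ck_partial|exact: CkW|exact: Ck_partial].
Qed.

Lemma CkZl (W : normedModType R) k D (f : 'rV[R]_n -> R^o) (w : W) : open D ->
  Ck k D f -> Ck k D (fun v => f v *: w).
Proof.
move=> oD; elim: k f => [|k IH] f fk.
  by split=> // x Dx; apply: differentiableZl; exact: Ck_differentiable Dx fk.
apply: (@Ck_step _ _ _ _ (fun i x => partial i f x *: w)) => // [x Dx|i].
  by apply: has_partialsZl; exact: Ck_partials Dx fk.
by apply: IH; exact: Ck_partial.
Qed.

Lemma CkN k D (f : 'rV[R]_n -> R^o) : open D ->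
  Ck k D f -> Ck k D (fun v => - f v : R^o).
Proof.
move=> oD fk; apply: (@eq_in_Ck R^o _ _ (fun v => -1 * f v : R^o)) => // [x _|].
  by rewrite mulN1r.
by apply: CkM => //; exact: Ck_cst.
Qed.

(** The chain rule reduces order [k.+1] of the composite with [g] to order [k] of the composite with
    [g']. For [expR] and the inverse, [g'] is an expression in [g], so induction closes; [ln]
    reduces to the inverse. *)
Lemma Ck_comp k D (f : 'rV[R]_n -> R^o) (g g' : R^o -> R^o) : open D ->
  (forall x, D x -> is_derive (f x) 1 g (g' (f x))) ->
  Ck k.+1 D f -> Ck k D (fun v => g' (f v) : R^o) ->
  Ck k.+1 D (fun v => g (f v) : R^o).
Proof.
move=> oD gg' fk gk.
apply: (@Ck_step R^o _ _ _ (fun i x => g' (f x) * partial i f x)) => // [x Dx|i].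
  by apply: has_partials_comp; [exact: gg'|exact: Ck_partials Dx fk].
by apply: CkM => //; exact: Ck_partial.
Qed.

Lemma Ck0_comp D (f : 'rV[R]_n -> R^o) (g g' : R^o -> R^o) :
  (forall x, D x -> is_derive (f x) 1 g (g' (f x))) ->
  Ck 0 D f -> Ck 0 D (fun v => g (f v) : R^o).
Proof.
move=> gg' fk; split=> // x Dx.
by have [] := has_partials_comp (gg' _ Dx) (Ck_partials Dx fk).
Qed.

Lemma Ck_expR k D (f : 'rV[R]_n -> R^o) : open D ->
  Ck k D f -> Ck k D (fun v => expR (f v) : R^o).
Proof.
move=> oD; elim: k => [|k IH] fk.
  by apply: (@Ck0_comp _ _ _ expR) => // x _; exact: is_derive_expR.
by apply: (Ck_comp (g' := expR) oD _ fk); exact/IH/CkW.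
Qed.

Lemma is_derive_inv (x : R) : x != 0 ->
  is_derive x 1 (GRing.inv : R^o -> R^o) (- (x^-1 * x^-1)).
Proof.
move=> x0; apply: is_derive_eq; first exact: (@is_deriveV _ id).
by rewrite /GRing.scale /= mulr1 expr2 invfM.
Qed.

Lemma CkV k D (f : 'rV[R]_n -> R^o) : open D -> (forall x, D x -> f x != 0) ->
  Ck k D f -> Ck k D (fun v => (f v)^-1 : R^o).
Proof.
move=> oD f0; elim: k => [|k IH] fk.
  apply: (@Ck0_comp _ _ _ (fun x => - (x^-1 * x^-1))) => // x /f0.
  exact: is_derive_inv.
apply: (Ck_comp (g' := fun x => - (x^-1 * x^-1)) oD _ fk) => [x /f0|].
  exact: is_derive_inv.
by apply: CkN => //; apply: CkM => //; apply/IH/CkW.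
Qed.

Lemma Ck_ln k D (f : 'rV[R]_n -> R^o) : open D -> (forall x, D x -> 0 < f x) ->
  Ck k D f -> Ck k D (fun v => ln (f v) : R^o).
Proof.
move=> oD f0; case: k => [|k] fk.
  by apply: (@Ck0_comp _ _ _ GRing.inv) => // x /f0; exact: is_derive1_ln.
apply: (Ck_comp (g' := GRing.inv) oD _ fk) => [x /f0|]; first exact: is_derive1_ln.
by apply: CkV => // [x /f0/gt_eqF->//|]; exact: CkW.
Qed.

End Ck.

(** * The profile of the sphere and its inverse *)

Section profile.
Context {R : realType} (p q : R) (hp : 2 <= p) (hpq : p^-1 + q^-1 = 1).
Implicit Types t w : R.

Lemma exponent_gt0 : 0 < p. Proof. have hp' := hp; lra. Qed.

Let p0 := exponent_gt0.

Lemma conj_exponentE : q = p / (p - 1).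
Proof.
have p1' : 0 < p - 1 by have hp' := hp; lra.
have p1 : p - 1 != 0 by rewrite gt_eqF.
rewrite -[q]invrK (_ : q^-1 = 1 - p^-1); last by rewrite -hpq addrC addKr.
by field; rewrite p1 gt_eqF.
Qed.

Lemma conj_exponent_gt1 : 1 < q.
Proof. by have hp' := hp; rewrite conj_exponentE ltr_pdivlMr; lra. Qed.

Let q1 := conj_exponent_gt1.
Let q0 : 0 < q := lt_trans ltr01 q1.

Lemma conj_exponent_le : q <= p.
Proof. by have hp' := hp; rewrite conj_exponentE ler_pdivrMr; nra. Qed.

Definition quad (c t : R) : R := t ^+ 2 + c + 1.

Lemma quad_gt0 c t : 0 < c -> 0 < quad c t.
Proof. by move=> c0; rewrite /quad -addrA ltr_wpDl ?sqr_ge0// addr_gt0. Qed.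

(** The polynomial N, when [quad p t] and [quad q t] are A and B; it is the numerator of the
    derivative of [profile]. *)
Definition cubic_weight t : R := 3 * t ^+ 2 + 2 * (p * q) + 1.

Lemma cubic_weight_gt0 t : 0 < cubic_weight t.
Proof.
have pq0 : 0 < p * q by rewrite mulr_gt0.
have t2 := sqr_ge0 t; rewrite /cubic_weight; lra.
Qed.

(** A^(1/2p) B^(1/2q), the square root of a weighted geometric mean, written as an exponential for
    ease of differentiation. *)
Definition halfmean t : R :=
  expR (2^-1 * (p^-1 * ln (quad p t) + q^-1 * ln (quad q t))).

Lemma halfmean_gt0 t : 0 < halfmean t. Proof. exact: expR_gt0. Qed.

(* The value of z / (x^(1/p) y^(1/q)) at the point of the sphere with
   parameter zeta = t. *)
Definition profile t : R := t / halfmean t.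

Lemma halfmean_sqr t :
  halfmean t ^+ 2 = expR (p^-1 * ln (quad p t) + q^-1 * ln (quad q t)).
Proof. by rewrite /halfmean -expRM_natl; congr expR; field; rewrite !gt_eqF. Qed.

(** The square is the geometric mean of A and B with weights 1/p and 1/q, so it lies between B and
    A, where B <= A because q <= p. *)
Lemma halfmean_sqr_le t : halfmean t ^+ 2 <= quad p t.
Proof.
have Ap := quad_gt0 t p0; have Bp := quad_gt0 t q0.
rewrite halfmean_sqr -[leRHS]lnK ?posrE// ler_expR.
have lAB : ln (quad q t) <= ln (quad p t).
  by rewrite ler_ln ?posrE// /quad; have := conj_exponent_le => qp; lra.
rewrite -[leRHS]mul1r -hpq mulrDl lerD2l ler_wpM2l// invr_ge0; exact: ltW.
Qed.

Lemma halfmean_sqr_ge t : quad q t <= halfmean t ^+ 2.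
Proof.
have Ap := quad_gt0 t p0; have Bp := quad_gt0 t q0.
rewrite halfmean_sqr -[leLHS]lnK ?posrE// ler_expR.
have lAB : ln (quad q t) <= ln (quad p t).
  by rewrite ler_ln ?posrE// /quad; have := conj_exponent_le => qp; lra.
rewrite -[leLHS]mul1r -hpq mulrDl lerD2r ler_wpM2l// invr_ge0; exact: ltW.
Qed.

Lemma profile_sqr t : profile t ^+ 2 = t ^+ 2 / halfmean t ^+ 2.
Proof. by rewrite /profile exprMn exprVn. Qed.

(** For nonzero [t] the left side is [t] times the logarithmic derivative of [profile]. The same
    quantity is the inverse of the rank-one coefficient in the Hessian. *)
Lemma profile_identity t :
  1 - t ^+ 2 / (p * quad p t) - t ^+ 2 / (q * quad q t) =
  cubic_weight t / (quad p t * quad q t).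
Proof.
have Ap := quad_gt0 t p0; have Bp := quad_gt0 t q0.
have p1' : 0 < p - 1 by have hp' := hp; lra.
have p1 : p - 1 != 0 by rewrite gt_eqF.
have pn0 : p != 0 by rewrite gt_eqF.
move: Ap Bp; rewrite /cubic_weight /quad conj_exponentE => Ap Bp.
have Ap' : t ^+ 2 + p + 1 != 0 by rewrite gt_eqF.
have Bp' : t ^+ 2 + p / (p - 1) + 1 != 0 by rewrite gt_eqF.
have Bp2 : t ^+ 2 * (p - 1) + p + (p - 1) != 0.
  have -> : t ^+ 2 * (p - 1) + p + (p - 1) = (t ^+ 2 + p / (p - 1) + 1) * (p - 1).
    by field.
  by rewrite mulf_neq0.
field. rewrite ?pn0 ?p1 ?Ap' ?Bp2 //=.
Qed.

(** Division by AB gives (1 + 1/p)/A + (1 + 1/q)/B = N/(AB), the cancellation behind the simple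
    gradient of the potential. *)
Lemma quad_weight_identity t :
  (1 + p^-1) * quad q t + (1 + q^-1) * quad p t = cubic_weight t.
Proof.
have p1' : 0 < p - 1 by have hp' := hp; lra.
have p1 : p - 1 != 0 by rewrite gt_eqF.
have pn0 : p != 0 by rewrite gt_eqF.
rewrite /cubic_weight /quad conj_exponentE; field.
by rewrite pn0 p1.
Qed.

Lemma is_derive_ln_quad c t : 0 < c ->
  is_derive t 1 (fun u => ln (quad c u)) (2 * t / quad c t).
Proof.
move=> c0; have qc := quad_gt0 t c0.
have dq : is_derive t 1 (quad c) (2 * t).
  rewrite /quad; apply: is_derive_eq.
  by rewrite /GRing.scale /=; ring.
have dln := is_derive1_ln qc.
by rewrite mulrC; exact: (is_derive1_comp (f := @ln R)).
Qed.

Lemma is_derive_halfmean t : is_derive t 1 halfmean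
  (halfmean t * (t / (p * quad p t) + t / (q * quad q t))).
Proof.
have dp := is_derive_ln_quad t p0; have dq := is_derive_ln_quad t q0.
have Ap := quad_gt0 t p0; have Bp := quad_gt0 t q0.
have dL : is_derive t 1
    (fun u => 2^-1 * (p^-1 * ln (quad p u) + q^-1 * ln (quad q u)))
    (t / (p * quad p t) + t / (q * quad q t)).
  have -> : (fun u => 2^-1 * (p^-1 * ln (quad p u) + q^-1 * ln (quad q u))) =
      2^-1 *: (p^-1 *: (fun u => ln (quad p u)) + q^-1 *: (fun u => ln (quad q u))).
    by [].
  apply: is_derive_eq; rewrite /GRing.scale /=.
  by field; rewrite !gt_eqF.
exact: (is_derive1_comp (f := @expR R)).
Qed.

Definition profile_derivative t : R :=
  cubic_weight t / (quad p t * quad q t * halfmean t).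

Lemma profile_derivative_gt0 t : 0 < profile_derivative t.
Proof. by rewrite divr_gt0 ?mulr_gt0 ?cubic_weight_gt0 ?quad_gt0 ?halfmean_gt0. Qed.

Lemma is_derive_profile t : is_derive t 1 profile (profile_derivative t).
Proof.
have Ap := quad_gt0 t p0; have Bp := quad_gt0 t q0; have Ep := halfmean_gt0 t.
have dE := is_derive_halfmean t.
have dV : is_derive t 1 (fun u => (halfmean u)^-1)
   (- (halfmean t) ^- 2 *: (halfmean t * (t / (p * quad p t) + t / (q * quad q t)))).
  by apply: is_deriveV; rewrite gt_eqF.
have -> : profile = id * (fun u => (halfmean u)^-1) by [].
have -> : profile_derivative t =
    (1 - t ^+ 2 / (p * quad p t) - t ^+ 2 / (q * quad q t)) / halfmean t.
  by rewrite profile_identity /profile_derivative; field; rewrite !gt_eqF.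
by apply: is_derive_eq; rewrite /GRing.scale /=; field; rewrite !gt_eqF.
Qed.

Lemma profile_homo : {homo profile : x y / x < y}.
Proof.
move=> x y xy; apply: (@gtr0_derive1_incr _ profile x y) => //.
- by move=> t _; have [] := is_derive_profile t.
- move=> t _; have [_] := is_derive_profile t; rewrite derive1E => ->.
  exact: profile_derivative_gt0.
- apply: continuous_subspaceT => t; apply: differentiable_continuous.
  by apply/derivable1_diffP; have [] := is_derive_profile t.
Qed.

Lemma profile_inj : injective profile.
Proof. exact: (inc_inj (le_mono profile_homo)). Qed.

(** Replacing the squared [halfmean] by its lower bound B turns the right side into exactly (q +
    1)/B. This keeps [profile] inside (-1, 1) and later controls the potential at the boundary. *)
Lemma profile_sqr_gap t : (q + 1) / quad q t <= 1 - profile t ^+ 2.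
Proof.
have Bp := quad_gt0 t q0; have E2 := halfmean_sqr_ge t.
have -> : (q + 1) / quad q t = 1 - t ^+ 2 / quad q t.
  by rewrite /quad in Bp *; field; rewrite gt_eqF.
rewrite profile_sqr lerD2l lerN2 ler_wpM2l ?sqr_ge0// lef_pV2 ?posrE//.
exact: lt_le_trans E2.
Qed.

Lemma profile_norm_lt1 t : `|profile t| < 1.
Proof.
rewrite -(@expr_lt1 _ 2)// real_normK ?num_real// -subr_gt0.
apply: lt_le_trans (profile_sqr_gap t).
by rewrite divr_gt0 ?quad_gt0// addr_gt0.
Qed.

Lemma profileN t : profile (- t) = - profile t.
Proof. by rewrite /profile /halfmean /quad sqrrN mulNr. Qed.

Lemma profile_surj w : `|w| < 1 -> exists t, profile t = w.
Proof.
move=> w1; have w2 : 0 < 1 - w ^+ 2.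
  by rewrite subr_gt0 -real_normK ?num_real// expr_lt1.
(* Chosen so that M^2 (1 - w^2) = M (p + 1) >= p + 1, which gives w^2 <= M^2/(M^2 + p + 1) <=
   [profile M ^+ 2]; the intermediate value theorem then applies on [-M, M] since [profile] is
   odd. *)
pose M := (p + 1) / (1 - w ^+ 2).
have M1 : 1 <= M.
  have := p0; have := sqr_ge0 w => ww pp; rewrite ler_pdivlMr//; lra.
have M0 : 0 < M by exact: lt_le_trans M1.
have wM : `|w| <= profile M.
  have Ap := quad_gt0 M p0.
  rewrite -[leRHS]ger0_norm; last by rewrite ltW// divr_gt0// halfmean_gt0.
  rewrite -ler_sqr ?nnegrE// !real_normK ?num_real// profile_sqr.
  apply: (@le_trans _ _ (M ^+ 2 / quad p M)); last first.
    rewrite ler_wpM2l ?sqr_ge0// lef_pV2 ?posrE ?halfmean_sqr_le//.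
    by rewrite exprn_gt0// halfmean_gt0.
  rewrite ler_pdivlMr// /quad.
  have : (p + 1) <= M ^+ 2 * (1 - w ^+ 2).
    rewrite -ler_pdivrMr// -/M; nra.
  have := sqr_ge0 w; have := p0; nra.
have [| | |t _ tw] := @IVT _ profile (- M) M w.
- by rewrite ge0_cp// ltW.
- apply: continuous_subspaceT => t; apply: differentiable_continuous.
  by apply/derivable1_diffP; have [] := is_derive_profile t.
- rewrite profileN minC maxC min_r ?max_l; first by rewrite -ler_norml.
  + by rewrite ge0_cp// (le_trans _ wM).
  + by rewrite ge0_cp// (le_trans _ wM).
by exists t.
Qed.

(** Outside (-1, 1) there is no preimage and [get] returns a default value. *)
Definition profile_inv w : R := get [set t | profile t = w].

Lemma profile_invK w : `|w| < 1 -> profile (profile_inv w) = w.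
Proof. by move=> /profile_surj ex; exact: (getPex ex). Qed.

Lemma profileK : cancel profile profile_inv.
Proof. by move=> t; apply: profile_inj; rewrite profile_invK// profile_norm_lt1. Qed.

Lemma is_derive_profile_inv w : `|w| < 1 ->
  is_derive w 1 profile_inv (profile_derivative (profile_inv w))^-1.
Proof.
move=> /profile_invK wE; rewrite -{1}wE; apply: is_derive_inverse.
- by near=> t; exact: profileK.
- near=> t; apply: differentiable_continuous.
  by apply/derivable1_diffP; have [] := is_derive_profile t.
- exact: is_derive_profile.
- by rewrite gt_eqF// profile_derivative_gt0.
Unshelve. all: by end_near. Qed.

End profile.

(** * The potential and its Hessian *)

Lemma forall_ord3 (P : 'I_3 -> Prop) : P 0 -> P 1 -> P 2 -> forall i, P i.
Proof.
move=> P0 P1 P2 [[|[|[|//]]] i3].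
- by rewrite (_ : Ordinal i3 = 0)//; exact: val_inj.
- by rewrite (_ : Ordinal i3 = 1)//; exact: val_inj.
- by rewrite (_ : Ordinal i3 = 2)//; exact: val_inj.
Qed.

Lemma sum_ord3 (V : nmodType) (F : 'I_3 -> V) :
  \sum_(i < 3) F i = F 0 + F 1 + F 2.
Proof.
by rewrite !big_ord_recl big_ord0 addr0 addrA; congr (_ + F _ + F _); exact: val_inj.
Qed.

Lemma det_mx33 (R : comNzRingType) (M : 'M[R]_3) : \det M =
  M 0 0 * (M 1 1 * M 2 2 - M 1 2 * M 2 1) -
  M 0 1 * (M 1 0 * M 2 2 - M 1 2 * M 2 0) +
  M 0 2 * (M 1 0 * M 2 1 - M 1 1 * M 2 0).
Proof.
(* Indexing by natural numbers lets the lifted indices of the cofactors compute, so that [ring]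
   recognises equal entries. *)
pose m (i j : nat) := M (inord i) (inord j).
have mE i j : M i j = m i j by rewrite /m !inord_val.
rewrite (expand_det_row _ 0) !big_ord_recl big_ord0 /cofactor.
rewrite !(expand_det_row _ 0) !big_ord_recl !big_ord0 /cofactor !det_mx11 !mxE.
rewrite !mE /= /bump /= !addn0 ?add0n.
by rewrite !expr0 !expr1 ?expr2; ring.
Qed.

Section potential.
Context {R : realType} (p q : R) (hp : 2 <= p) (hpq : p^-1 + q^-1 = 1).
Implicit Types v : 'rV[R]_3.

Let p0 : 0 < p := exponent_gt0 hp.
Let q0 : 0 < q := lt_trans ltr01 (conj_exponent_gt1 hp hpq).

Definition cone_scale v : R := expR (- (p^-1 * ln (v 0 0) + q^-1 * ln (v 0 1))).

Definition cone_ratio v : R := v 0 2 * cone_scale v.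

(** This turns out to be the interior of the cone; the last condition places the ratio in the domain
    where [profile_inv] inverts [profile]. *)
Definition open_power_cone : set 'rV[R]_3 :=
  [set v : 'rV[R]_3 | [/\ 0 < v 0 0, 0 < v 0 1 & `|cone_ratio v| < 1]].

(* The parameter zeta of the sphere point on the ray through [v], written as a
   function on the cone. *)
Definition slope v : R := profile_inv p q (cone_ratio v).

Definition potential v : R := - (2^-1 * ln (p * q)) +
  ((1 + p^-1) * (2^-1 * ln (quad p (slope v)) - ln (v 0 0)) +
   (1 + q^-1) * (2^-1 * ln (quad q (slope v)) - ln (v 0 1))).

Lemma has_partials_ln_coord v (j : 'I_3) : 0 < v 0 j ->
  has_partials (fun u => ln (u 0 j) : R^o) v (fun i => (v 0 j)^-1 * (i == j)%:R).
Proof.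
move=> vj; apply: (has_partials_comp (f := fun u => u 0 j : R^o)).
  exact: is_derive1_ln.
exact: has_partials_coord.
Qed.

Lemma has_partials_cone_scale v : 0 < v 0 0 -> 0 < v 0 1 ->
  has_partials (cone_scale : _ -> R^o) v (fun i => - cone_scale v *
    (p^-1 * ((v 0 0)^-1 * (i == 0)%:R) + q^-1 * ((v 0 1)^-1 * (i == 1)%:R))).
Proof.
move=> x0 y0; apply: has_partials_eq.
  apply: (has_partials_comp (g := @expR R)).
  apply/has_partialsN/has_partialsD; apply/has_partialsZ;
    exact: has_partials_ln_coord.
by move=> i /=; rewrite -/(cone_scale v) mulrN mulNr.
Qed.

Lemma has_partials_cone_ratio v : 0 < v 0 0 -> 0 < v 0 1 ->
  has_partials (cone_ratio : _ -> R^o) v (fun i => cone_scale v * (i == 2)%:R -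
    cone_ratio v * (p^-1 * ((v 0 0)^-1 * (i == 0)%:R) +
                    q^-1 * ((v 0 1)^-1 * (i == 1)%:R))).
Proof.
move=> x0 y0; apply: has_partials_eq.
  exact: has_partialsM (has_partials_coord 2 v) (has_partials_cone_scale x0 y0).
by move=> i /=; rewrite /cone_ratio; ring.
Qed.

Lemma open_open_power_cone : open open_power_cone.
Proof.
rewrite openE => v [x0 y0 w1].
have cx : {for v, continuous (fun u : 'rV[R]_3 => u 0 0)} by exact: coord_continuous.
have cy : {for v, continuous (fun u : 'rV[R]_3 => u 0 1)} by exact: coord_continuous.
have cw : {for v, continuous (fun u => `|cone_ratio u|)}.
  apply: continuous_comp; last exact: norm_continuous.
  by have [/differentiable_continuous] := has_partials_cone_ratio x0 y0.
have nx := cvgr_gt _ cx _ x0; have ny := cvgr_gt _ cy _ y0.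
have nw := cvgr_lt _ cw _ w1.
rewrite /interior; near=> u; split; near: u; [exact: nx|exact: ny|exact: nw].
Unshelve. all: by end_near.
Qed.

(* The Hessian of the potential is [S *m (diag d + 2 k w^T w) *m S], where [S] is
   the diagonal matrix of the [hessian_scale], [d] is [hessian_diag], [w] is
   [hessian_dir] and [k] is [hessian_coef]. *)
Definition hessian_scale v (i : 'I_3) : R :=
  [:: (v 0 0)^-1; (v 0 1)^-1; cone_scale v * halfmean p q (slope v)]`_i.

Definition hessian_diag v (i : 'I_3) : R :=
  [:: quad p (slope v) / p; quad q (slope v) / q; -1]`_i.

Definition hessian_dir v (i : 'I_3) : R := [:: slope v / p; slope v / q; -1]`_i.

Definition hessian_coef v : R :=
  quad p (slope v) * quad q (slope v) / cubic_weight p q (slope v).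

Definition potential_grad v (i : 'I_3) : R :=
  [:: - (quad p (slope v) / p); - (quad q (slope v) / q); slope v]`_i *
  hessian_scale v i.

Lemma cone_ratioE v : open_power_cone v ->
  cone_ratio v = slope v / halfmean p q (slope v).
Proof. by move=> [_ _ w1]; rewrite -/(profile p q _) profile_invK. Qed.

(** The gradient of the slope is a multiple of the scaled direction [hessian_dir]. The rank-one part
    of the Hessian comes from here, as [potential_grad] depends on the point through the slope. *)
Lemma has_partials_slope v : open_power_cone v ->
  has_partials (slope : _ -> R^o) v
    (fun i => - hessian_coef v * hessian_scale v i * hessian_dir v i).
Proof.
move=> Dv; have [x0 y0 w1] := Dv; apply: has_partials_eq.
  apply: (has_partials_comp (g := profile_inv p q)).
    exact: is_derive_profile_inv.
  exact: has_partials_cone_ratio.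
have Ap := quad_gt0 (slope v) p0; have Bp := quad_gt0 (slope v) q0.
have Ep := halfmean_gt0 p q (slope v); have Np := cubic_weight_gt0 hp hpq (slope v).
apply: forall_ord3; rewrite /= /hessian_coef /hessian_scale /hessian_dir /=
  -/(slope v) (cone_ratioE Dv) /profile_derivative; field; rewrite !gt_eqF//.
Qed.

Lemma has_partials_quad_slope c v : open_power_cone v ->
  has_partials (fun u => quad c (slope u) : R^o) v (fun i => 2 * slope v *
    (- hessian_coef v * hessian_scale v i * hessian_dir v i)).
Proof.
move=> Dv; apply: has_partials_comp (has_partials_slope Dv).
rewrite /quad; apply: is_derive_eq.
by rewrite /GRing.scale /=; ring.
Qed.

Lemma has_partials_ln_quad_slope c v : 0 < c -> open_power_cone v ->
  has_partials (fun u => ln (quad c (slope u)) : R^o) v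
    (fun i => (quad c (slope v))^-1 * (2 * slope v *
    (- hessian_coef v * hessian_scale v i * hessian_dir v i))).
Proof.
move=> c0 Dv; apply: has_partials_comp (has_partials_quad_slope c Dv).
exact: is_derive1_ln (quad_gt0 _ c0).
Qed.

Lemma has_partials_potential v : open_power_cone v ->
  has_partials (potential : _ -> R^o) v (potential_grad v).
Proof.
move=> Dv; have [x0 y0 w1] := Dv; apply: has_partials_eq.
  apply: has_partialsD; first exact: has_partials_cst.
  apply: has_partialsD; apply/has_partialsZ/has_partialsD;
    [|apply/has_partialsN/has_partials_ln_coord/x0|
     |apply/has_partialsN/has_partials_ln_coord/y0];
    by apply/has_partialsZ/has_partials_ln_quad_slope.
have Ap := quad_gt0 (slope v) p0; have Bp := quad_gt0 (slope v) q0.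
have Ep := halfmean_gt0 p q (slope v); have Np := cubic_weight_gt0 hp hpq (slope v).
set A := quad p _ in Ap *; set B := quad q _ in Bp *.
(* The contributions of ln A and ln B through the slope add up to N/(AB), which cancels
   [hessian_coef]. *)
have key c : (1 + p^-1) * (2^-1 * (A^-1 * (2 * slope v * (- hessian_coef v * c)))) +
    (1 + q^-1) * (2^-1 * (B^-1 * (2 * slope v * (- hessian_coef v * c)))) =
    - (slope v * c).
  rewrite /hessian_coef -/A -/B; apply/eqP; rewrite -subr_eq0; apply/eqP.
  have Nq := quad_weight_identity hp hpq (slope v); rewrite -/A -/B in Nq.
  rewrite (_ : _ - _ = slope v * c * (1 - ((1 + p^-1) * B + (1 + q^-1) * A) /
     cubic_weight p q (slope v))); last by field; rewrite !gt_eqF.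
  by rewrite Nq divff ?gt_eqF// subrr mulr0.
move=> i; rewrite /= add0r !mulrBr addrACA -!(mulrA (- _)) key; move: i.
apply: forall_ord3; rewrite /= /potential_grad /hessian_scale /hessian_dir /=
  -/A -/B /A /B /quad; field; rewrite !gt_eqF//.
Qed.

Lemma has_partials_inv_coord v (j : 'I_3) : 0 < v 0 j ->
  has_partials (fun u => (u 0 j)^-1 : R^o) v
    (fun i => - ((v 0 j)^-1 * (v 0 j)^-1) * (i == j)%:R).
Proof.
move=> vj; apply: (has_partials_comp (f := fun u => u 0 j : R^o)).
  by apply: is_derive_inv; rewrite gt_eqF.
exact: has_partials_coord.
Qed.

Lemma has_partials_potential_grad v j : open_power_cone v ->
  has_partials (fun u => potential_grad u j : R^o) v
    (fun i => hessian_scale v i * hessian_scale v j *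
      ((i == j)%:R * hessian_diag v i +
       2 * hessian_coef v * hessian_dir v i * hessian_dir v j)).
Proof.
move=> Dv; have [x0 y0 w1] := Dv.
have Ap := quad_gt0 (slope v) p0; have Bp := quad_gt0 (slope v) q0.
have Ep := halfmean_gt0 p q (slope v); have Np := cubic_weight_gt0 hp hpq (slope v).
move: j; apply: forall_ord3.
- apply: has_partials_eq.
    rewrite /potential_grad /hessian_scale /=.
    apply: has_partialsM (has_partials_inv_coord x0).
    apply: has_partialsN; apply: has_partialsM (has_partials_cst _ _).
    exact: has_partials_quad_slope.
  apply: forall_ord3; rewrite /= /hessian_coef /hessian_scale /hessian_dir
    /hessian_diag /=; field; rewrite !gt_eqF//.
- apply: has_partials_eq.
    rewrite /potential_grad /hessian_scale /=.
    apply: has_partialsM (has_partials_inv_coord y0).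
    apply: has_partialsN; apply: has_partialsM (has_partials_cst _ _).
    exact: has_partials_quad_slope.
  apply: forall_ord3; rewrite /= /hessian_coef /hessian_scale /hessian_dir
    /hessian_diag /=; field; rewrite !gt_eqF//.
- have dE := is_derive_halfmean hp hpq (slope v).
  apply: has_partials_eq.
    rewrite /potential_grad /hessian_scale /=.
    apply: has_partialsM; first exact: has_partials_slope.
    apply: has_partialsM; first exact: has_partials_cone_scale.
    exact: has_partials_comp (has_partials_slope Dv).
  have key := profile_identity hp hpq (slope v).
  set z := slope v in key Ap Bp Ep Np *.
  (* [z] times the logarithmic derivative of [halfmean] is 1 - 1/c, with c the coefficient
     [hessian_coef]. So c (1 + z k) = 2c - 1: the 2c is the rank-one update, and the -1 combines
     with the derivative of [cone_scale] into the diagonal part. *)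
  have {}key : z * (z / (p * quad p z) + z / (q * quad q z)) =
      1 - cubic_weight p q z / (quad p z * quad q z).
    by rewrite -key; field; rewrite !gt_eqF.
  move=> i /=; set c := hessian_coef v; set s := hessian_scale v i.
  set e := hessian_dir v i.
  set k := _ / _ + _ / _ in key *.
  set l := p^-1 * _ + _.
  transitivity (- (cone_scale v * halfmean p q z *
    (c * s * e * (1 + z * k) + z * l))); first by ring.
  rewrite key {}/s {}/e {}/l {k key} /c; move: i; apply: forall_ord3;
    rewrite /= /hessian_coef /hessian_scale /hessian_dir
    /hessian_diag -/z /=; field; rewrite !gt_eqF//.
Qed.

Lemma hessian_potential v i j : open_power_cone v ->
  hessian potential v i j = hessian_scale v i * hessian_scale v j *
      ((i == j)%:R * hessian_diag v i +
       2 * hessian_coef v * hessian_dir v i * hessian_dir v j).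
Proof.
move=> Dv; rewrite mxE; have [_ <-] := has_partials_potential_grad j Dv.
apply: near_eq_derive.
apply: filterS (open_nbhs_nbhs (conj open_open_power_cone Dv)) => u Du.
by have [_ ->] := has_partials_potential Du.
Qed.

End potential.

(** * The Monge-Ampere equation, convexity, smoothness and decay estimate *)

Section solution.
Context {R : realType} (p q : R) (hp : 2 <= p) (hpq : p^-1 + q^-1 = 1).
Implicit Types v : 'rV[R]_3.

Let p0 : 0 < p := exponent_gt0 hp.
Let q0 : 0 < q := lt_trans ltr01 (conj_exponent_gt1 hp hpq).

Local Notation slope := (slope p q).
Local Notation cone_scale := (cone_scale p q).
Local Notation D := (open_power_cone p q).

Lemma expR_2potential v : D v -> expR (2 * potential p q v) =
  ((v 0 0)^-1 * (v 0 1)^-1 * (cone_scale v * halfmean p q (slope v))) ^+ 2 *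
  (quad p (slope v) * quad q (slope v) / (p * q)).
Proof.
move=> [x0 y0 _].
have Ap := quad_gt0 (slope v) p0; have Bp := quad_gt0 (slope v) q0.
have pq0 : 0 < p * q by rewrite mulr_gt0.
(* Every positive factor becomes the exponential of its logarithm, leaving an identity that is
   linear in these logarithms. *)
rewrite -[X in X^-1 * _ * _]lnK ?posrE// -[X in _ * X^-1 * _]lnK ?posrE//.
rewrite -[X in X * _ / _]lnK ?posrE// -[X in _ * X / _]lnK ?posrE//.
rewrite -[X in _ * _ / X]lnK ?posrE// -!expRN expr2 /halfmean /cone_scale.
rewrite -!expRD /potential; congr expR.
by field; rewrite !gt_eqF.
Qed.

Lemma det_hessian_potential v : D v ->
  \det (hessian (potential p q) v) = expR (2 * potential p q v).
Proof.
move=> Dv; have [x0 y0 _] := Dv.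
rewrite expR_2potential// det_mx33 !hessian_potential//=.
have Ap := quad_gt0 (slope v) p0; have Bp := quad_gt0 (slope v) q0.
have Np := cubic_weight_gt0 hp hpq (slope v).
have key := profile_identity hp hpq (slope v).
rewrite /hessian_scale /hessian_diag /hessian_dir /hessian_coef /=.
move: key; set z := slope v; set A := quad p z in Ap *; set B := quad q z in Bp *.
set N := cubic_weight p q z in Np *; set E := cone_scale v * _ => key.
(* Matrix determinant lemma for the rank-one update. By [profile_identity] the last factor is 1 - 2
   = -1. *)
transitivity (((v 0 0)^-1 * (v 0 1)^-1 * E) ^+ 2 * - (A * B / (p * q)) *
   (1 - 2 * (A * B / N) * (1 - z ^+ 2 / (p * A) - z ^+ 2 / (q * B)))).
  by field; rewrite !gt_eqF.
by rewrite key; field; rewrite !gt_eqF.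
Qed.

(* By Cauchy-Schwarz the hypothesis bounds [(a c0 + b c1)^2] by [1 - 1/k] times
   the positive part of the form. *)
Lemma rank_one_update_gt0 (al be a b k c0 c1 c2 : R) : 0 < al -> 0 < be -> 0 < k ->
  a ^+ 2 / al + b ^+ 2 / be = 1 - k^-1 ->
  [|| c0 != 0, c1 != 0 | c2 != 0] ->
  0 < al * c0 ^+ 2 + be * c1 ^+ 2 - c2 ^+ 2 +
      2 * k * (a * c0 + b * c1 - c2) ^+ 2.
Proof.
move=> al0 be0 k0 ab c_neq0.
have k1 : 1 <= k.
  rewrite -invf_le1// -subr_ge0 -ab.
  by rewrite addr_ge0// divr_ge0 ?sqr_ge0// ltW.
have K0 : 0 < 2 * k - 1 by lra.
set r := a * c0 + b * c1.
set X := al * c0 ^+ 2 + be * c1 ^+ 2.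
have cs : (1 - k^-1) * X - r ^+ 2 = (a * be * c1 - b * al * c0) ^+ 2 / (al * be).
  by rewrite -ab /X /r; field; rewrite !gt_eqF.
have cs0 : 0 <= (1 - k^-1) * X - r ^+ 2.
  by rewrite cs divr_ge0 ?sqr_ge0// mulr_ge0// ltW.
have X0 : 0 <= X by rewrite addr_ge0// mulr_ge0 ?sqr_ge0// ltW.
rewrite -(pmulr_rgt0 _ K0).
(* Multiplication by 2k - 1 > 0 completes the square in [c2]. The remainder is the Cauchy-Schwarz
   gap plus [X], which is positive unless [c0] and [c1] vanish; in that case the square is
   positive. *)
have -> : (2 * k - 1) * (X - c2 ^+ 2 + 2 * k * (r - c2) ^+ 2) =
    X + ((2 * k - 1) * c2 - 2 * k * r) ^+ 2 + 2 * k * ((1 - k^-1) * X - r ^+ 2).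
  by field; rewrite gt_eqF.
apply: ltr_wpDr; first by rewrite mulr_ge0// mulr_ge0// ltW.
have [c0E|c0n] := eqVneq c0 0; last first.
  apply: ltr_wpDr; first exact: sqr_ge0.
  apply: ltr_wpDr; first by rewrite mulr_ge0 ?sqr_ge0// ltW.
  by rewrite mulr_gt0// exprn_even_gt0.
have [c1E|c1n] := eqVneq c1 0; last first.
  apply: ltr_wpDr; first exact: sqr_ge0.
  apply: ltr_wpDl; first by rewrite mulr_ge0 ?sqr_ge0// ltW.
  by rewrite mulr_gt0// exprn_even_gt0.
move: c_neq0; rewrite c0E c1E eqxx /= => c2n.
rewrite ltr_wpDl// /r c0E c1E !mulr0 addr0 mulr0 subr0 exprn_even_gt0//=.
by rewrite mulf_neq0// gt_eqF.
Qed.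

Lemma pos_def_hessian_potential v : D v -> pos_def (hessian (potential p q) v).
Proof.
move=> Dv; have [x0 y0 _] := Dv; split.
  apply/matrixP => i j; rewrite mxE !hessian_potential// eq_sym.
  by case: eqVneq => [->//|_]; rewrite /= !mul0r; ring.
move=> u u0.
have Ap := quad_gt0 (slope v) p0; have Bp := quad_gt0 (slope v) q0.
have Np := cubic_weight_gt0 hp hpq (slope v).
(* The diagonal congruence is absorbed into the vector; as the scales are nonzero, [c] vanishes only
   where [u] does. *)
pose c i := u 0 i * hessian_scale p q v i.
have cE i : (c i != 0) = (u 0 i != 0).
  rewrite /c mulf_eq0 negb_or [X in _ && X](_ : _ = true) ?andbT//.
  move: i; apply: forall_ord3; rewrite /hessian_scale /= ?gt_eqF ?invr_gt0//.
  by rewrite mulr_gt0 ?expR_gt0.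
have key : (slope v / p) ^+ 2 / (quad p (slope v) / p) +
    (slope v / q) ^+ 2 / (quad q (slope v) / q) = 1 - (hessian_coef p q v)^-1.
  rewrite /hessian_coef [X in _ = _ - X]invf_div -/(slope v)
    -(profile_identity hp hpq (slope v)).
  by field; rewrite !gt_eqF.
have := @rank_one_update_gt0 _ _ _ _ _ (c 0) (c 1) (c 2) _ _ _ key.
rewrite !cE !divr_gt0 ?mulr_gt0// => /(_ isT isT isT).
have un0 : [|| u 0 0 != 0, u 0 1 != 0 | u 0 2 != 0].
  apply: contraNT u0; rewrite !negb_or !negbK => /and3P[/eqP e0 /eqP e1 /eqP e2].
  by apply/eqP/rowP; apply: forall_ord3; rewrite !mxE.
move=> /(_ un0); congr (_ < _).
rewrite !mxE sum_ord3 !mxE !sum_ord3 !hessian_potential//= /c /hessian_diag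
  /hessian_dir /=; field; rewrite !gt_eqF//.
Qed.

Section smoothness.
Let oD := @open_open_power_cone R p q.

Let x_gt0 v : D v -> 0 < v 0 0. Proof. by case. Qed.
Let y_gt0 v : D v -> 0 < v 0 1. Proof. by case. Qed.

Lemma Ck_cone_scale k : Ck k D (cone_scale : _ -> R^o).
Proof.
apply: Ck_expR => //; apply: CkN => //; apply: CkD => //;
  by apply: CkM => //; [exact: Ck_cst|apply: Ck_ln => //; exact: Ck_coord].
Qed.

Lemma Ck_quad n k (U : set 'rV[R]_n) (f : 'rV[R]_n -> R^o) c : open U ->
  Ck k U f -> Ck k U (fun u => quad c (f u) : R^o).
Proof.
move=> oU fk; apply: CkD => //; last exact: Ck_cst.
apply: CkD => //; last exact: Ck_cst.
by rewrite [X in Ck _ _ X](_ : _ = fun u => f u * f u)//; exact: CkM.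
Qed.

Lemma Ck_halfmean k (U : set 'rV[R]_3) (f : 'rV[R]_3 -> R^o) : open U ->
  Ck k U f -> Ck k U (fun v => halfmean p q (f v) : R^o).
Proof.
move=> oU fk; apply: Ck_expR => //; apply: CkM => //; first exact: Ck_cst.
apply: CkD => //; (apply: CkM => //; first exact: Ck_cst);
  by apply: Ck_ln => // [v _|]; [exact: quad_gt0|exact: Ck_quad].
Qed.

(* Bootstrap: the partial derivatives of the slope are smooth expressions in the
   slope itself. *)
Lemma Ck_slope k : Ck k D (slope : _ -> R^o).
Proof.
elim: k => [|k IH].
  by split=> // v Dv; have [] := has_partials_slope hp hpq Dv.
apply: (@Ck_step _ _ R^o _ _ _ (fun i v =>
  - hessian_coef p q v * hessian_scale p q v i * hessian_dir p q v i)) => //.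
  by move=> v Dv; exact: has_partials_slope.
move=> i; apply: CkM => //; first apply: CkM => //.
- apply: CkN => //; apply: CkM => //; first by apply: CkM => //; exact: Ck_quad.
  apply: CkV => // [v _|]; first by rewrite gt_eqF// cubic_weight_gt0.
  rewrite /cubic_weight; do 2 (apply: CkD => //; last exact: Ck_cst).
  apply: CkM => //; first exact: Ck_cst.
  by rewrite [X in Ck _ _ X](_ : _ = fun v => slope v * slope v)//; exact: CkM.
- move: i; apply: forall_ord3; rewrite /hessian_scale /=.
  + by apply: CkV => // [v /x_gt0/gt_eqF->//|]; exact: Ck_coord.
  + by apply: CkV => // [v /y_gt0/gt_eqF->//|]; exact: Ck_coord.
  + by apply: CkM => //; [exact: Ck_cone_scale|exact: Ck_halfmean].
- move: i; apply: forall_ord3; rewrite /hessian_dir /=; last exact: Ck_cst.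
  + by apply: CkM => //; exact: Ck_cst.
  + by apply: CkM => //; exact: Ck_cst.
Qed.

Lemma smooth_potential : smooth_on D (potential p q : _ -> R^o).
Proof.
apply: Ck_smooth => k; apply: CkD => //; first exact: Ck_cst.
have lnq c : 0 < c -> Ck k D (fun v => 2^-1 * ln (quad c (slope v)) : R^o).
  move=> c0; apply: CkM => //; first exact: Ck_cst.
  apply: Ck_ln => // [v _|]; first exact: quad_gt0.
  by apply: Ck_quad => //; exact: Ck_slope.
apply: CkD => //; (apply: CkM => //; first exact: Ck_cst);
  (apply: CkD => //; [exact: lnq|apply: CkN => //; apply: Ck_ln => //]);
  exact: Ck_coord.
Qed.

End smoothness.

(* The right-hand side, which is [C x^(1/q) y^(1/p) (x^(2/p) y^(2/q) - z^2)],
   vanishes on the whole boundary of the cone. *)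
Lemma expRN_potential_le v : D v -> expR (- potential p q v) <=
  expR (2^-1 * ln (p * q)) * (1 - cone_ratio p q v ^+ 2) *
  expR ((1 + p^-1) * ln (v 0 0) + (1 + q^-1) * ln (v 0 1)).
Proof.
move=> Dv; have [x0 y0 w1] := Dv.
have Ap := quad_gt0 (slope v) p0; have Bp := quad_gt0 (slope v) q0.
have q1 := conj_exponent_gt1 hp hpq.
have gap : (quad q (slope v))^-1 <= 1 - cone_ratio p q v ^+ 2.
  rewrite -{1}(profile_invK hp hpq w1) -/(slope v).
  apply: le_trans (profile_sqr_gap hp hpq _).
  by rewrite ler_peMl ?invr_ge0 ?(ltW Bp)// lerDr ltW.
apply: (@le_trans _ _ (expR (2^-1 * ln (p * q)) * (quad q (slope v))^-1 *
  expR ((1 + p^-1) * ln (v 0 0) + (1 + q^-1) * ln (v 0 1)))); last first.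
  by rewrite ler_wpM2r ?expR_ge0// ler_wpM2l ?expR_ge0.
rewrite -[X in _ * X^-1]lnK ?posrE// -expRN -!expRD ler_expR /potential.
(* Since A >= B >= 1, the factor A^(-(1 + 1/p)/2) B^(-(1 + 1/q)/2) is at most B^(-3/2), hence at
   most 1/B. *)
have lAB : ln (quad q (slope v)) <= ln (quad p (slope v)).
  by rewrite ler_ln ?posrE// /quad lerD2r lerD2l conj_exponent_le.
have lB : 0 <= ln (quad q (slope v)).
  by rewrite ln_ge0// /quad lerDr addr_ge0 ?sqr_ge0// ltW.
have lp : 0 <= p^-1 * (ln (quad p (slope v)) - ln (quad q (slope v))).
  by rewrite mulr_ge0 ?subr_ge0// invr_ge0 ltW.
have e : q^-1 = 1 - p^-1 by rewrite -hpq addrC addKr.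
rewrite e; lra.
Qed.

End solution.

(** * The power cone *)

Section pospow.
Context {R : realType}.
Implicit Types a x : R.

(* [powR] is 1 at negative bases; truncating the base at 0 makes the power
   continuous on the whole line. *)
Definition pospow a x : R := (Num.max 0 x) `^ a.

Lemma pospow_ge0 a x : 0 <= pospow a x. Proof. exact: powR_ge0. Qed.

Lemma pospowE a x : 0 <= x -> pospow a x = x `^ a.
Proof. by move=> x0; rewrite /pospow max_r. Qed.

Lemma pospow_expR a x : 0 < x -> pospow a x = expR (a * ln x).
Proof. by move=> x0; rewrite pospowE ?(ltW x0)// /powR gt_eqF. Qed.

Lemma pospow0 a : 0 < a -> pospow a 0 = 0.
Proof. by move=> a0; rewrite pospowE// powR0// gt_eqF. Qed.

Lemma continuous_pospow a : 0 < a -> continuous (pospow a).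
Proof.
move=> a0 x; have [x0|x0|->] := ltgtP x 0.
- have e : {near x, (fun=> 0) =1 pospow a}.
    near=> y; rewrite /pospow max_l ?powR0 ?gt_eqF// ltW//.
    by near: y; exact: lt_nbhsl.
  apply: cvg_trans; first exact: near_eq_cvg e.
  by rewrite -(nbhs_singleton e); exact: cvg_cst.
- have e : {near x, (fun y : R => y `^ a) =1 pospow a}.
    near=> y; rewrite pospowE// ltW//.
    by near: y; exact: lt_nbhsr.
  apply: cvg_trans; first exact: near_eq_cvg e.
  have c : {for x, continuous (fun y : R => y `^ a)}.
    apply/differentiable_continuous/derivable1_diffP.
    by have [] := @is_derive1_powR R a x x0.
  by rewrite -(nbhs_singleton e); exact: c.
- rewrite /continuous_at pospow0//; apply/cvgr0Pnorm_lt => e e0.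
  have d0 : 0 < e `^ a^-1 by rewrite powR_gt0.
  near=> y; rewrite ger0_norm ?pospow_ge0// /pospow.
  have yd : Num.max 0 y < e `^ a^-1.
    by rewrite gt_max d0/=; near: y; exact: lt_nbhsl.
  have := gt0_ltr_powR a0 _ _ yd.
  rewrite !nnegrE le_max lexx powR_ge0 => /(_ isT isT).
  by rewrite -powRrM mulVf ?gt_eqF// powRr1// ltW.
Unshelve. all: by end_near. Qed.

End pospow.

(** * Interior and regularity of the power cone, and blow-up of the potential at its boundary *)

Section cone.
Context {R : realType} (p q : R) (hp : 2 <= p) (hpq : p^-1 + q^-1 = 1).
Implicit Types v : 'rV[R]_3.

Let p0 : 0 < p := exponent_gt0 hp.
Let q0 : 0 < q := lt_trans ltr01 (conj_exponent_gt1 hp hpq).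
Let pV0 : 0 < p^-1. Proof. by rewrite invr_gt0. Qed.
Let qV0 : 0 < q^-1. Proof. by rewrite invr_gt0. Qed.

Definition cone_bound v : R := pospow p^-1 (v 0 0) * pospow q^-1 (v 0 1).

Lemma continuous_cone_bound : continuous cone_bound.
Proof.
move=> v; apply: (@continuousM _ _ (fun u : 'rV[R]_3 => pospow p^-1 (u 0 0))
  (fun u : 'rV[R]_3 => pospow q^-1 (u 0 1)));
  (apply: continuous_comp; [exact: coord_continuous|exact: continuous_pospow]).
Qed.

Lemma power_coneP v : power_cone p q v <->
  [/\ 0 <= v 0 0, 0 <= v 0 1 & `|v 0 2| <= cone_bound v].
Proof.
rewrite /power_cone /=; split=> [[h1 h2 x0 y0]|[x0 y0]].
  by split=> //; rewrite ler_norml /cone_bound !pospowE// h1 h2.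
by rewrite ler_norml /cone_bound !pospowE// => /andP[].
Qed.

Lemma cone_boundE v : 0 < v 0 0 -> 0 < v 0 1 -> cone_bound v = (cone_scale p q v)^-1.
Proof.
by move=> x0 y0; rewrite /cone_bound !pospow_expR// /cone_scale expRN invrK expRD.
Qed.

Lemma open_power_coneP v : open_power_cone p q v <->
  [/\ 0 < v 0 0, 0 < v 0 1 & `|v 0 2| < cone_bound v].
Proof.
split=> -[x0 y0]; rewrite ?cone_boundE// /cone_ratio => h; split=> //.
  by rewrite -[_^-1]mul1r ltr_pdivlMr ?expR_gt0//
    -{1}[cone_scale _ _ _]gtr0_norm ?expR_gt0// -normrM.
rewrite normrM [X in _ * X]gtr0_norm ?expR_gt0// -ltr_pdivlMr ?expR_gt0//.
by rewrite mul1r.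
Qed.

Lemma open_power_cone_sub : open_power_cone p q `<=` power_cone p q.
Proof.
move=> v /open_power_coneP[x0 y0 z].
by apply/power_coneP; split; apply: ltW.
Qed.

(** By continuity of the line at t = 0. Small moves along signed coordinate directions make the weak
    inequalities of the cone strict in its interior. *)
Lemma interior_line (K : set 'rV[R]_3) v e : K° v ->
  exists2 t : R, 0 < t & K (v + t *: e).
Proof.
move=> Kv.
have c : {for 0, continuous (fun t : R => v + t *: e)}.
  apply: continuousD; first exact: cst_continuous.
  by apply: continuousZr_tmp; exact: cvg_id.
have nK : \forall t \near (0 : R), K (v + t *: e).
  by apply: c; rewrite scale0r addr0.
near ((0 : R)^'+) => t; exists t => //.
by near: t; exact: cvg_within nK.
Unshelve. all: by end_near. Qed.

Lemma interior_power_cone : (power_cone p q)° = open_power_cone p q.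
Proof.
apply/seteqP; split=> [v Kv|]; last first.
  rewrite -open_subsetE; first exact: open_power_cone_sub.
  exact: open_open_power_cone.
have [t t0 /power_coneP[+ _ _]] := interior_line (- delta_mx 0 0) Kv.
rewrite !mxE /= mulrN mulr1 subr_ge0 => tx.
have [s s0 /power_coneP[_ + _]] := interior_line (- delta_mx 0 1) Kv.
rewrite !mxE /= mulrN mulr1 subr_ge0 => sy.
apply/open_power_coneP; split; [exact: lt_le_trans tx|exact: lt_le_trans sy|].
have [r r0 /power_coneP[_ _ +]] := interior_line (delta_mx 0 2) Kv.
have [r' r'0 /power_coneP[_ _ +]] := interior_line (- delta_mx 0 2) Kv.
rewrite /cone_bound !mxE /= !oppr0 !mulr0 !addr0 mulrN !mulr1 !ler_norml =>
  /andP[h1 h2] /andP[h3 h4].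
rewrite ltr_norml; lra.
Qed.

Lemma closed_nonneg (f : 'rV[R]_3 -> R) :
  continuous f -> closed [set v | 0 <= f v].
Proof.
move=> cf; have := @preimage_closed _ _ f [set y : R | 0 <= y] (fun v _ => cf v).
by apply; exact: closed_ge.
Qed.

Lemma closed_power_cone : closed (power_cone p q).
Proof.
have -> : power_cone p q = [set v : 'rV[R]_3 | 0 <= v 0 0] `&`
   [set v : 'rV[R]_3 | 0 <= v 0 1] `&` [set v | 0 <= cone_bound v - `|v 0 2|].
  apply/seteqP; split=> v; first by move/power_coneP => -[? ? ?]; rewrite /= subr_ge0.
  by move=> [[? ?]]; rewrite /= subr_ge0 => ?; apply/power_coneP.
apply: closedI; first apply: closedI; apply: closed_nonneg => v.
- exact: coord_continuous.
- exact: coord_continuous.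
- apply: continuousB; first exact: continuous_cone_bound.
  by apply: continuous_comp; [exact: coord_continuous|exact: norm_continuous].
Qed.

(** Hoelder's inequality for two terms says that x^(1/p) y^(1/q) is superadditive. *)
Lemma power_coneD u v : power_cone p q u -> power_cone p q v -> power_cone p q (u + v).
Proof.
move=> /power_coneP[ux uy uz] /power_coneP[vx vy vz]; apply/power_coneP.
rewrite /cone_bound !mxE; split; [exact: addr_ge0|exact: addr_ge0|].
apply: (le_trans (ler_normD _ _)); apply: (le_trans (lerD uz vz)).
have := @hoelder2 R (pospow p^-1 (u 0 0)) (pospow p^-1 (v 0 0))
   (pospow q^-1 (u 0 1)) (pospow q^-1 (v 0 1)) p q
   (pospow_ge0 _ _) (pospow_ge0 _ _) (pospow_ge0 _ _) (pospow_ge0 _ _) p0 q0 hpq.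
rewrite /cone_bound !pospowE ?addr_ge0//.
by rewrite -!powRrM !mulVf ?gt_eqF// !powRr1.
Qed.

(** The bound is homogeneous of degree 1/p + 1/q = 1. The value t = 0 is included because a weight
    of a convex combination may vanish. *)
Lemma power_coneZ v (t : R) : 0 <= t -> power_cone p q v -> power_cone p q (t *: v).
Proof.
move=> t0 /power_coneP[x0 y0 z]; apply/power_coneP; rewrite /cone_bound !mxE.
split; [exact: mulr_ge0|exact: mulr_ge0|].
rewrite normrM ger0_norm// !pospowE ?mulr_ge0// !powRM// mulrACA.
have [->|tn0] := eqVneq t 0; first by rewrite !mul0r mulr_ge0// mulr_ge0 ?powR_ge0.
rewrite -powRD ?tn0 ?implybT// hpq powRr1// ler_wpM2l//.
by move: z; rewrite /cone_bound !pospowE.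
Qed.

Lemma regular_power_cone : regular_convex_cone (power_cone p q).
Proof.
split.
- by move=> v t Kv t0; apply: power_coneZ => //; exact: ltW.
- move=> u v l; rewrite !inE => Ku Kv.
  have l0 : 0 <= l%:num by [].
  have l1 : 0 <= unstable.onem l%:num by rewrite unstable.onem_ge0.
  exact: power_coneD (power_coneZ l0 Ku) (power_coneZ l1 Kv).
- exact: closed_power_cone.
- exists (row3 1 1 0); rewrite interior_power_cone.
  by split; rewrite /cone_ratio !mxE /= ?ltr01// mul0r normr0 ltr01.
- move=> [v [e [e0 line]]]; move/eqP: e0; apply.
  have coord0 (j : 'I_3) : (forall t, 0 <= v 0 j + t * e 0 j) -> e 0 j = 0.
    move=> h; apply/eqP/negPn/negP => en0.
    (* At this parameter the coordinate would be -1. *)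
    have := h (- (v 0 j + 1) / e 0 j); rewrite divfK//; lra.
  have ex : e 0 0 = 0.
    by apply: coord0 => t; have /power_coneP[+ _ _] := line t; rewrite !mxE.
  have ey : e 0 1 = 0.
    by apply: coord0 => t; have /power_coneP[_ + _] := line t; rewrite !mxE.
  have ez : e 0 2 = 0.
    apply/eqP/negPn/negP => en0.
    (* Along the line x and y are now constant, hence so is the bound; at this parameter z would
       exceed it by 1. *)
    have /power_coneP[_ _] := line ((cone_bound v + 1 - v 0 2) / e 0 2).
    rewrite /cone_bound !mxE ex ey !mulr0 !addr0 divfK// addrC subrK -/(cone_bound v).
    by move/(le_trans (ler_norm _)); lra.
  by apply/rowP; apply: forall_ord3; rewrite ?ex ?ey ?ez mxE.
Qed.

(** On the interior, e^(-F) is at most a constant times a function [d] that is continuous on the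
    whole space. At a boundary point x = 0, y = 0 or |z| equals the bound, so [d] vanishes there and
    F tends to infinity. *)
Lemma potential_blowup b : (closure (power_cone p q) `\` (power_cone p q)°) b ->
  potential p q x @[x --> within (power_cone p q)° (nbhs b)] --> +oo.
Proof.
rewrite -(closure_id _).1; last exact: closed_power_cone.
rewrite interior_power_cone => -[/power_coneP[x0 y0 z0] nDb].
pose d v := pospow q^-1 (v 0 0) * pospow p^-1 (v 0 1) *
  (cone_bound v ^+ 2 - v 0 2 ^+ 2).
have csqr (f : 'rV[R]_3 -> R) : continuous f -> continuous (fun u => f u ^+ 2).
  move=> cf v; have := continuousM (cf v) (cf v).
  by congr (_ --> _); apply/funext.
have cd : continuous d.
  move=> v; apply: (@continuousM _ _
    (fun u : 'rV[R]_3 => pospow q^-1 (u 0 0) * pospow p^-1 (u 0 1))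
    (fun u => cone_bound u ^+ 2 - u 0 2 ^+ 2)); last apply: continuousB.
  - by apply: (@continuousM _ _ (fun u : 'rV[R]_3 => pospow q^-1 (u 0 0))
      (fun u : 'rV[R]_3 => pospow p^-1 (u 0 1)));
      (apply: continuous_comp; [exact: coord_continuous|exact: continuous_pospow]).
  - exact: csqr continuous_cone_bound v.
  - by apply: csqr => u; exact: coord_continuous.
have db0 : d b = 0.
  rewrite /d; have [->|xn0] := eqVneq (b 0 0) 0; first by rewrite pospow0// !mul0r.
  have [->|yn0] := eqVneq (b 0 1) 0; first by rewrite (pospow0 pV0) mulr0 mul0r.
  have xp : 0 < b 0 0 by rewrite lt_def xn0.
  have yp : 0 < b 0 1 by rewrite lt_def yn0.
  suff -> : b 0 2 ^+ 2 = cone_bound b ^+ 2 by rewrite subrr mulr0.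
  rewrite -[LHS]real_normK ?num_real//; congr (_ ^+ 2); apply: le_anti; rewrite z0/=.
  by rewrite leNgt; apply/negP => h; apply: nDb; apply/open_power_coneP.
have bound v : open_power_cone p q v ->
    expR (- potential p q v) <= expR (2^-1 * ln (p * q)) * d v.
  move=> Dv; have [xp yp _] := Dv.
  apply: (le_trans (expRN_potential_le hp hpq Dv)); rewrite -mulrA ler_wpM2l ?expR_ge0//.
  rewrite /d !pospow_expR// cone_boundE// /cone_ratio /cone_scale -!expRN !opprK.
  have e : q^-1 = 1 - p^-1 by rewrite -hpq addrC addKr.
  set m := expR (- _).
  have -> : expR (p^-1 * ln (v 0 0) + q^-1 * ln (v 0 1)) = m^-1 by rewrite -expRN opprK.
  have -> : expR ((1 + p^-1) * ln (v 0 0) + (1 + q^-1) * ln (v 0 1)) =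
      expR (q^-1 * ln (v 0 0)) * expR (p^-1 * ln (v 0 1)) * m^-1 * m^-1.
    by rewrite -[m^-1]expRN opprK -!expRD; congr expR; rewrite e; ring.
  rewrite le_eqVlt; apply/orP; left; apply/eqP; field.
  by rewrite gt_eqF// expR_gt0.
apply/cvgryPge => M.
have eM : 0 < expR (- M) / expR (2^-1 * ln (p * q)) by rewrite divr_gt0 ?expR_gt0.
have nd : \forall v \near b, d v < expR (- M) / expR (2^-1 * ln (p * q)).
  by apply: (cvgr_lt _ (cd b)); rewrite db0.
rewrite near_withinE; near=> v => Dv.
have dv : d v < expR (- M) / expR (2^-1 * ln (p * q)) by near: v; exact: nd.
rewrite ltr_pdivlMr ?expR_gt0// mulrC in dv.
by have := le_lt_trans (bound _ Dv) dv; rewrite ltr_expR ltrN2 => /ltW.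
Unshelve. all: by end_near. Qed.

Lemma monge_ampere_potential : monge_ampere_solution (power_cone p q) (potential p q).
Proof.
split; rewrite ?interior_power_cone.
- exact: smooth_potential.
- by move=> v; exact: det_hessian_potential.
- by move=> v; exact: pos_def_hessian_potential.
- by rewrite -interior_power_cone => b; exact: potential_blowup.
Qed.

End cone.

(** * The affine sphere *)

Section sphere.
Context {R : realType} (p q : R) (hp : 2 <= p) (hpq : p^-1 + q^-1 = 1).
Implicit Types (v : 'rV[R]_3) (u : 'rV[R]_2).

Let p0 : 0 < p := exponent_gt0 hp.
Let q0 : 0 < q := lt_trans ltr01 (conj_exponent_gt1 hp hpq).

Local Notation sphere := (power_sphere p q).
Local Notation slope := (slope p q).
Local Notation D := (open_power_cone p q).

Lemma conj_exponent_mul : p * q = p + q.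
Proof.
have : p * q * (p^-1 + q^-1) = p * q by rewrite hpq mulr1.
by move=> <-; field; rewrite !gt_eqF.
Qed.

(** Logarithm of a coordinate of the sphere, apart from the factor zeta of the third one, which may
    be zero or negative. *)
Definition sphere_exponent (s t m : R) u : R :=
  - 6^-1 * ln (p + q) + (s * ln (quad p (u 0 0)) + t * ln (quad q (u 0 0)) + m * u 0 1).

Definition sphere_x := sphere_exponent
  ((p + 1) / (6 * p)) ((q + 1) / (6 * q)) ((q + 1) / (3 * q)).
Definition sphere_y := sphere_exponent
  ((p + 1) / (6 * p)) ((q + 1) / (6 * q)) (- ((p + 1) / (3 * p))).
Definition sphere_z := sphere_exponent
  ((p - 2) / (6 * p)) ((q - 2) / (6 * q)) (- ((p - q) / (3 * (p + q)))).

Lemma powR_expR (x a : R) : 0 < x -> x `^ a = expR (a * ln x).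
Proof. by move=> x0; rewrite /powR gt_eqF. Qed.

Lemma power_sphereE u : sphere u =
  row3 (expR (sphere_x u)) (expR (sphere_y u)) (u 0 0 * expR (sphere_z u)).
Proof.
have Ap := quad_gt0 (u 0 0) p0; have Bp := quad_gt0 (u 0 0) q0.
have pq0 : 0 < p + q by rewrite addr_gt0.
rewrite /power_sphere -/(quad p _) -/(quad q _).
rewrite /sphere_x /sphere_y /sphere_z /sphere_exponent !expRD !powR_expR//.
apply/rowP; apply: forall_ord3; rewrite !mxE //=.
by ring.
Qed.

(** With pq for p + q, the coefficients are affine in 1/p and 1/q, so that substituting 1/q = 1 -
    1/p settles the later identities. *)
Lemma sphere_xE u : sphere_x u = - 6^-1 * ln (p * q) +
  ((1 + p^-1) / 6 * ln (quad p (u 0 0)) + (1 + q^-1) / 6 * ln (quad q (u 0 0)) +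
   (1 + q^-1) / 3 * u 0 1).
Proof.
rewrite /sphere_x /sphere_exponent -conj_exponent_mul.
by field; rewrite !gt_eqF.
Qed.

Lemma sphere_yE u : sphere_y u = - 6^-1 * ln (p * q) +
  ((1 + p^-1) / 6 * ln (quad p (u 0 0)) + (1 + q^-1) / 6 * ln (quad q (u 0 0)) -
   (1 + p^-1) / 3 * u 0 1).
Proof.
rewrite /sphere_y /sphere_exponent -conj_exponent_mul.
by field; rewrite !gt_eqF.
Qed.

Lemma sphere_zE u : sphere_z u = - 6^-1 * ln (p * q) +
  ((1 - 2 * p^-1) / 6 * ln (quad p (u 0 0)) +
   (1 - 2 * q^-1) / 6 * ln (quad q (u 0 0)) + (p^-1 - q^-1) / 3 * u 0 1).
Proof.
rewrite /sphere_z /sphere_exponent -conj_exponent_mul.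
by field; rewrite !gt_eqF.
Qed.

Let qVE : q^-1 = 1 - p^-1. Proof. by rewrite -hpq addrC addKr. Qed.

(** The coefficients of mu differ by (2 + 1/p + 1/q)/3 = 1, and the other terms agree. *)
Lemma sphere_gap u : sphere_x u - sphere_y u = u 0 1.
Proof. by rewrite sphere_xE sphere_yE qVE; field; rewrite gt_eqF. Qed.

(** In exponential form, z = zeta x^(1/p) y^(1/q) / [halfmean]: the invariant ratio on the sphere is
    the profile of zeta. *)
Lemma sphere_zXY u : sphere_z u = p^-1 * sphere_x u + q^-1 * sphere_y u -
  2^-1 * (p^-1 * ln (quad p (u 0 0)) + q^-1 * ln (quad q (u 0 0))).
Proof. by rewrite sphere_xE sphere_yE sphere_zE qVE; field; rewrite gt_eqF. Qed.

Lemma sphere_coord u : [/\ sphere u 0 0 = expR (sphere_x u),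
  sphere u 0 1 = expR (sphere_y u) & sphere u 0 2 = u 0 0 * expR (sphere_z u)].
Proof. by rewrite power_sphereE; split; rewrite mxE. Qed.

Lemma cone_ratio_sphere u : cone_ratio p q (sphere u) = profile p q (u 0 0).
Proof.
have [x y z] := sphere_coord u.
rewrite /cone_ratio /cone_scale x y z !expRK sphere_zXY /profile /halfmean -expRN.
by rewrite -mulrA -expRD; congr (_ * expR _); ring.
Qed.

Lemma sphere_in_cone u : D (sphere u).
Proof.
have [x y _] := sphere_coord u.
by split; rewrite ?x ?y ?expR_gt0// cone_ratio_sphere profile_norm_lt1.
Qed.

Lemma slope_sphere u : slope (sphere u) = u 0 0.
Proof. by rewrite /slope cone_ratio_sphere profileK. Qed.

Lemma potential_sphere u : potential p q (sphere u) = 0.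
Proof.
have [x y _] := sphere_coord u.
rewrite /potential slope_sphere x y !expRK sphere_xE sphere_yE qVE.
by field; rewrite gt_eqF.
Qed.

Lemma potential_eq0_sphere v : D v -> potential p q v = 0 ->
  v = sphere (\row_(i < 2) [:: slope v; ln (v 0 0) - ln (v 0 1)]`_i).
Proof.
move=> Dv; have [x0 y0 w1] := Dv; set u := \row_ _ _.
have u0 : u 0 0 = slope v by rewrite mxE.
have u1 : u 0 1 = ln (v 0 0) - ln (v 0 1) by rewrite mxE.
rewrite /potential => pot0.
(* F = 0 and mu = ln x - ln y are two linear equations for ln x and ln y, of determinant 2 + 1/p +
   1/q = 3. *)
have xE : sphere_x u = ln (v 0 0).
  by move: pot0; rewrite sphere_xE u0 u1 qVE => pot0; lra.
have yE : sphere_y u = ln (v 0 1).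
  by move: pot0; rewrite sphere_yE u0 u1 qVE => pot0; lra.
rewrite power_sphereE; apply/rowP; apply: forall_ord3; rewrite !mxE /=.
- by rewrite xE lnK.
- by rewrite yE lnK.
- rewrite sphere_zXY xE yE u0 expRB -/(halfmean p q (slope v)) mulrA mulrAC.
  rewrite -(cone_ratioE hp hpq Dv) /cone_ratio /cone_scale -mulrA -expRD.
  by rewrite addNr expR0 mulr1.
Qed.

Lemma smooth_power_sphere : smooth_on setT sphere.
Proof.
apply: Ck_smooth => k; have oT : open [set: 'rV[R]_2] by exact: openT.
have exE s t m : Ck k setT (fun u => expR (sphere_exponent s t m u) : R^o).
  have lnq c : 0 < c -> Ck k setT (fun u : 'rV[R]_2 => ln (quad c (u 0 0)) : R^o).
    move=> c0; apply: Ck_ln => // [u _|]; first exact: quad_gt0.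
    by apply: Ck_quad => //; exact: Ck_coord.
  apply: Ck_expR => //; apply: CkD => //; first exact: Ck_cst.
  apply: CkD => //; first apply: CkD => //; apply: CkM => //; try exact: Ck_cst.
  - exact: lnq.
  - exact: lnq.
  - exact: Ck_coord.
apply: (@eq_in_Ck _ _ _ _ _ (fun u => expR (sphere_x u) *: delta_mx 0 0 +
   expR (sphere_y u) *: delta_mx 0 1 +
   (u 0 0 * expR (sphere_z u)) *: delta_mx 0 2 : 'rV[R]_3)) => //.
  move=> u _; rewrite power_sphereE; apply/rowP; apply: forall_ord3;
    by rewrite !mxE /= ?mulr1 ?mulr0 ?addr0 ?add0r.
apply: CkD => //; first apply: CkD => //; apply: CkZl => //; try exact: exE.
by apply: CkM => //; [exact: Ck_coord|exact: exE].
Qed.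

(* [slope] and [ln x - ln y] form a differentiable left inverse of the
   parametrisation, so its differential is injective. *)
Lemma row_free_jacobian_sphere u : row_free ('J sphere u).
Proof.
apply: inj_row_free => e.
have ds : differentiable sphere u by exact: (smooth_power_sphere [::]).
rewrite -deriveEjacobian// deriveE// => de0.
have Dsu := sphere_in_cone u.
have left_inverse (g : 'rV[R]_3 -> R^o) j : differentiable g (sphere u) ->
    (forall w, g (sphere w) = w 0 j) -> e 0 j = 0.
  (* The coordinate of [e] is the derivative along [e] of [g] composed with the sphere, which
     factors through the vanishing image of [e]. *)
  move=> dg gE; rewrite -(derive_coord j u) (_ : (fun _ => _) = g \o sphere); last first.
    by apply/funext => w; rewrite /= gE.
  rewrite deriveE; last exact: differentiable_comp.
  by rewrite diff_comp//= de0 linear0.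
have e0 : e 0 0 = 0.
  apply: (left_inverse slope); last exact: slope_sphere.
  by have [] := has_partials_slope hp hpq Dsu.
have e1 : e 0 1 = 0.
  have [x0 y0 _] := Dsu.
  apply: (left_inverse (fun v => ln (v 0 0) - ln (v 0 1) : R^o)).
    apply: differentiableB.
      by have [] := has_partials_ln_coord x0.
    by have [] := has_partials_ln_coord y0.
  by move=> w; have [-> -> _] := sphere_coord w; rewrite !expRK sphere_gap.
apply/rowP => -[[|[|//]] i2]; rewrite mxE.
- by rewrite -[RHS]e0; congr (e 0 _); exact: val_inj.
- by rewrite -[RHS]e1; congr (e 0 _); exact: val_inj.
Qed.

End sphere.

(** * The canonical potential and its zero level set *)

Theorem mainTheorem3 (R : realType) (p q : R)
    (hp : 2 <= p) (hpq : p^-1 + q^-1 = 1) :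
  regular_convex_cone (power_cone p q) /\
  forall F : 'rV[R]_3 -> R, canonical_potential (power_cone p q) F ->
    smooth_immersion (power_sphere p q) /\
    [set v | (power_cone p q)° v /\ F v = 0] = range (power_sphere p q).
Proof.
split=> [|F [_ uniqF]]; first exact: regular_power_cone.
(* The uniqueness clause, applied to the explicit solution, identifies F on the interior only; the
   level set is taken there. *)
have FE v : open_power_cone p q v -> F v = potential p q v.
  move=> Dv; apply/esym/uniqF; rewrite ?interior_power_cone//.
  exact: monge_ampere_potential.
split.
  split; [exact: smooth_power_sphere|exact: row_free_jacobian_sphere].
rewrite interior_power_cone//; apply/seteqP; split=> [v [Dv]|_ [u _ <-]].
  rewrite FE// => /(potential_eq0_sphere hp hpq Dv) ->.
  by eexists.
have Du := sphere_in_cone hp hpq u.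
by split=> //; rewrite FE// potential_sphere.
Qed.
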